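(* Let $\mathcal S\subset\{-1,0,1\}^d$ be a weighted small-step set which is irreducible in the orthant, meaning that for any two lattice points $P,Q\in\mathbb Z_{\ge0}^d$ there is a walk of some length $n\ge1$ from $P$ to $Q$ with all steps in $\mathcal S$ and all points in $\mathbb R_+^d$, with combinatorial group $G=\langle\varphi_1,\dots,\varphi_d\rangle$ and reflection group $H=\langle r_1,\dots,r_d\rangle$; let $J$, $S_i=J(\varphi_i)$, $[\cdot,\cdot]$, $\Phi$ and $\widetilde\Phi$ be as defined in the context. Then the restriction of $\widetilde\Phi$ to $\mathrm{Im}\,J$ is an isomorphism between the two reflection groups $\mathrm{Im}\,J$ and $H$ such that $\widetilde\Phi(S_i)=r_i$ for all $i$. In particular, $\widetilde\Phi\circ J:G\to H$ is a surjective morphism that sends the set of generators $(\varphi_1,\dots,\varphi_d)$ of $G$ to the set of generators $(r_1,\dots,r_d)$ of $H$ (with $\varphi_i\mapsto r_i$).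
   Context: Setting. $d\ge1$, $\mathcal S\subset\{-1,0,1\}^d$ is a step set; each $s\in\mathcal S$ carries a weight $w(s)>0$, normalized by $\sum_{s\in\mathcal S}w(s)=1$. For $P,Q\in\mathbb Z_{\ge0}^d$, $e_C(P,Q;n)$ denotes the weighted number of walks of length $n$ from $P$ to $Q$ with steps in $\mathcal S$ and all points in the orthant $C=\mathbb R_+^d$. Irreducibility: for any two lattice points $P,Q\in\mathbb Z_{\ge 0}^d$ there is $n\ge1$ with $e_C(P,Q;n)\neq0$. Inventory: $\chi_{\mathcal S}(x_1,\dots,x_d)=\sum_{s\in\mathcal S}w(s)x_1^{s_1}\cdots x_d^{s_d}$. Under irreducibility (known fact) the system $\partial\chi_{\mathcal S}/\partial x_1=\dots=\partial\chi_{\mathcal S}/\partial x_d=0$ has a unique solution $\boldsymbol{x_0}$ in $(0,\infty)^d$, which is the minimum of $\chi_{\mathcal S}$ on $(0,\infty)^d$. Covariance matrix: $\Delta=(a_{i,j})$ with $a_{i,j}=\dfrac{\partial_{x_i}\partial_{x_j}\chi_{\mathcal S}(\boldsymbol{x_0})}{\sqrt{\partial_{x_i}^2\chi_{\mathcal S}(\boldsymbol{x_0})\,\partial_{x_j}^2\chi_{\mathcal S}(\boldsymbol{x_0})}}$. It is symmetric positive definite with unit diagonal; $\Delta^{1/2}$ is its symmetric positive definite square root. Group $G$: for each $i$ write $\chi_{\mathcal S}=x_iA_i+B_i+x_i^{-1}C_i$ with $A_i,B_i,C_i$ Laurent polynomials not depending on $x_i$. Let $\varphi_i$ be the birational involution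 replacing the $i$-th coordinate $x_i$ by $\frac{1}{x_i}\frac{C_i}{A_i}$ and fixing the other coordinates. $G=\langle\varphi_1,\dots,\varphi_d\rangle$ is the group of birational transformations they generate. Every $g\in G$ is regular at $\boldsymbol{x_0}$ and fixes $\boldsymbol{x_0}$. Group $H$: with $(e_i)$ the canonical basis of $\mathbb R^d$ and $u_i=\Delta^{1/2}e_i$, let $H_i=\langle u_i\rangle^\perp$ (orthogonal for the standard scalar product $\langle\cdot,\cdot\rangle$), $r_i$ the orthogonal reflection with respect to the hyperplane $H_i$, and $H=\langle r_1,\dots,r_d\rangle\subset O(\mathbb R^d,\langle\cdot,\cdot\rangle)$. Maps: $J:G\to GL_d(\mathbb R)$, $J(g)=\mathrm{Jac}_{\boldsymbol{x_0}}g$ (Jacobian matrix at $\boldsymbol{x_0}$), which is a group morphism. $[h,k]=\sum_{i,j}\frac{\partial^2\chi_{\mathcal S}}{\partial x_i\partial x_j}(\boldsymbol{x_0})h_ik_j$, which is a scalar product on $\mathbb R^d$ invariant under $\mathrm{Im}\,J$. $f_i=e_i/\sqrt{[e_i,e_i]}$, and $\Phi:\mathbb R^d\to\mathbb R^d$ is the linear map with $\Phi(f_i)=u_i$, which is an isometry from $(\mathbb R^d,[\cdot,\cdot])$ to $(\mathbb R^d,\langle\cdot,\cdot\rangle)$. $\widetilde\Phi:O(\mathbb R^d,[\cdot,\cdot])\to O(\mathbb R^d,\langle\cdot,\cdot\rangle)$ is the isomorphism $\widetilde\Phi(s)=\Phi\circ s\circ\Phi^{-1}$. *)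

(* Defs.v *)
From HB Require Import structures.
From mathcomp Require Import all_boot all_order all_algebra finmap fraction.
From mathcomp Require mpoly.
From mathcomp Require Import classical_sets boolp functions reals topology normedtype.
From mathcomp Require Import derive.
(* The notations of multinomials and of MathComp-Analysis are incompatible. *)
Import -(notations) mpoly.

Set Implicit Arguments.
Unset Strict Implicit.
Unset Printing Implicit Defensive.

Import Order.TTheory GRing.Theory Num.Theory.
Import numFieldNormedType.Exports.

Local Open Scope classical_set_scope.
Local Open Scope ring_scope.

(* Conventions: lattice points and points of affine space (the arguments of
   functions) are row vectors; vectors on which matrices act are column vectors,
   and matrices act on the left. *)

Section Walks.
Variable d : nat.

Definition small_steps (S : {fset 'rV[int]_d}) : Prop :=
  forall s i, s \in S -> s 0 i \in [:: -1; 0; 1].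

Definition in_orthant (P : 'rV[int]_d) : bool := [forall i, 0 <= P 0 i].

(* [P :: l] lists the successive points of a walk of length [size l]. *)
Definition walk (S : {fset 'rV[int]_d}) (P Q : 'rV[int]_d)
    (l : seq 'rV[int]_d) : bool :=
  [&& path (fun x y => y - x \in S) P l, all in_orthant (P :: l)
    & last P l == Q].

Definition irreducible_in_orthant (S : {fset 'rV[int]_d}) : Prop :=
  forall P Q, in_orthant P -> in_orthant Q ->
  exists n l, [/\ (1 <= n)%N, size l = n & walk S P Q l].

End Walks.

(* The inventory is evaluated both at real points ([F = R]) and at the generic
   point ([F] the field of rational functions); [phi] embeds the weights. *)
Section Inventory.
Variables (R F : fieldType) (phi : R -> F) (d : nat).
Variables (S : {fset 'rV[int]_d}) (w : 'rV[int]_d -> R).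
Implicit Types (x : 'rV[F]_d) (i : 'I_d).

Definition inventory x : F :=
  \sum_(s <- S) phi (w s) * \prod_j x 0 j ^ s 0 j.

(* The coefficient of [x_i ^ e] in the inventory. *)
Definition inventory_coef i (e : int) x : F :=
  \sum_(s <- S | s 0 i == e) phi (w s) * \prod_(j | j != i) x 0 j ^ s 0 j.

Lemma inventory_split i x : small_steps S -> x 0 i != 0 ->
  inventory x = x 0 i * inventory_coef i 1 x + inventory_coef i 0 x
                + (x 0 i)^-1 * inventory_coef i (-1) x.
Proof.
move=> sS xi0; rewrite /inventory /inventory_coef !mulr_sumr.
rewrite [X in X + _ + _]big_mkcond [X in _ + X + _]big_mkcond.
rewrite [X in _ + X]big_mkcond -!big_split !big_seq; apply: eq_bigr => s sS'.
rewrite (bigD1 i) //=; have := sS s i sS'; rewrite !inE.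
case/or3P => /eqP ->; rewrite /= ?expr1z ?expr0z ?exprN1 ?mul1r;
  by rewrite ?addr0 ?add0r // mulrCA.
Qed.

End Inventory.

Section RationalMaps.
Variables (R : fieldType) (d : nat).

Definition ratfun : fieldType := {fraction mpoly d R}.

Definition ratconst (c : R) : ratfun := tofrac (mpolyC d c).

Definition generic_point : 'rV[ratfun]_d :=
  \row_i tofrac (mpolyX R (mnm1 i)).

Section Value.
Variables (F : fieldType) (phi : R -> F) (y : 'rV[F]_d).

(* The value at [y] of a rational function, computed on any fraction [p / q]
   representing it whose denominator does not vanish at [y]: this set has one
   element if the function is regular at [y], and is empty otherwise. *)
Definition ratvalues (f : ratfun) : set F :=
  [set v | exists p q : mpoly d R,
    [/\ f = tofrac p / tofrac q, mmap phi (y 0) q != 0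
      & v = mmap phi (y 0) p / mmap phi (y 0) q]].

Definition ratval (f : ratfun) : F := xget 0 (ratvalues f).

Definition ratmap_eval (g : 'rV[ratfun]_d) : 'rV[F]_d := \row_j ratval (g 0 j).

End Value.

(* [g \o h], i.e. [g] evaluated at the generic point [h]. *)
Definition ratmap_comp (g h : 'rV[ratfun]_d) : 'rV[ratfun]_d :=
  ratmap_eval ratconst h g.

Variables (S : {fset 'rV[int]_d}) (w : 'rV[int]_d -> R).

Definition involution_gen (i : 'I_d) : 'rV[ratfun]_d :=
  let X := generic_point in
  let A := inventory_coef ratconst S w i 1 X in
  let C := inventory_coef ratconst S w i (-1) X in
  \row_j (if j == i then (X 0 i)^-1 * (C / A) else X 0 j).

End RationalMaps.

(* The subgroup generated by [A], a set of invertible elements for the law [op]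
   with unit [e]. *)
Inductive generated (T : Type) (op : T -> T -> T) (e : T) (A : set T) :
    T -> Prop :=
| generated_in x : A x -> generated op e A x
| generated_unit : generated op e A e
| generated_op x y :
    generated op e A x -> generated op e A y -> generated op e A (op x y)
| generated_inv x y :
    generated op e A x -> op x y = e -> op y x = e -> generated op e A y.

Definition group_morphism (T U : Type) (opT : T -> T -> T) (opU : U -> U -> U)
    (A : set T) (B : set U) (f : T -> U) : Prop :=
  (forall x, A x -> B (f x)) /\
  (forall x y, A x -> A y -> f (opT x y) = opU (f x) (f y)).

Definition group_isomorphism (T U : Type) (opT : T -> T -> T)
    (opU : U -> U -> U) (A : set T) (B : set U) (f : T -> U) : Prop :=
  group_morphism opT opU A B f /\ set_bij A B f.

Section Reflections.
Variables (R : realType) (d : nat).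
Implicit Types (B M : 'M[R]_d) (h k v : 'cV[R]_d).

Definition bform B h k : R := \sum_i \sum_j B i j * h i 0 * k j 0.

Definition posdefmx M : Prop :=
  M^T = M /\ forall v, v != 0 -> 0 < bform M v v.

Definition posdef_sqrtmx M (D : 'M[R]_d) : Prop := posdefmx D /\ D *m D = M.

Definition basis_vec (i : 'I_d) : 'cV[R]_d := delta_mx i 0.

(* The orthogonal reflection for [bform B] (with [B] symmetric) with respect to
   the hyperplane orthogonal to [v]; see [reflectionE]. *)
Definition reflection B v : 'M[R]_d :=
  1%:M - (2 / bform B v v) *: (v *m v^T *m B).

Lemma bformE B h k : bform B h k = (h^T *m B *m k) 0 0.
Proof.
rewrite /bform -mulmxA mxE; apply: eq_bigr => i _.
rewrite !mxE mulr_sumr; apply: eq_bigr => j _.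
by rewrite [B i j * _]mulrC mulrA.
Qed.

Lemma reflectionE B v h :
  reflection B v *m h = h - (2 * bform B v h / bform B v v) *: v.
Proof.
rewrite /reflection mulmxBl mul1mx -scalemxAl; congr (_ - _).
rewrite -!mulmxA [v^T *m _]mx11_scalar mul_mx_scalar scalerA mulmxA -bformE.
by rewrite mulrAC.
Qed.

Definition mxgroup (A : set 'M[R]_d) : set 'M[R]_d :=
  generated (fun M N => M *m N) 1%:M A.

Definition reflection_group B (A : set 'M[R]_d) : Prop :=
  exists2 V : set 'cV[R]_d, forall v, V v -> 0 < bform B v v
    & A = mxgroup (reflection B @` V).

End Reflections.

Section Setting.
Variables (R : realType) (d : nat).
Variables (S : {fset 'rV[int]_d}) (w : 'rV[int]_d -> R).

Definition chi : 'rV[R]_d -> R := inventory idfun S w.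

Definition partial (i : 'I_d) (f : 'rV[R]_d -> R) : 'rV[R]_d -> R :=
  fun x => 'D_(delta_mx 0 i) f x.

Definition critical_point (x : 'rV[R]_d) : Prop :=
  (forall i, 0 < x 0 i) /\ (forall i, partial i chi x = 0).

Definition hessian (x : 'rV[R]_d) : 'M[R]_d :=
  \matrix_(i, j) partial i (partial j chi) x.

Definition covariance (x : 'rV[R]_d) : 'M[R]_d :=
  \matrix_(i, j)
    (hessian x i j / Num.sqrt (hessian x i i * hessian x j j)).

Definition combinatorial_group : set 'rV[ratfun R d]_d :=
  generated (@ratmap_comp R d) (generic_point R d)
    (range (involution_gen S w)).

(* The library's ['J f x] acts on row vectors on the right; its transpose is the
   usual matrix of the partial derivatives of the coordinates. *)
Definition jac (x : 'rV[R]_d) (g : 'rV[ratfun R d]_d) : 'M[R]_d :=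
  ('J (fun y => ratmap_eval idfun y g) x)^T.

Definition simple_reflection (D : 'M[R]_d) (i : 'I_d) : 'M[R]_d :=
  reflection 1%:M (D *m basis_vec R i).

Definition reflection_group_of (D : 'M[R]_d) : set 'M[R]_d :=
  mxgroup (range (simple_reflection D)).

Definition normalized_basis (x : 'rV[R]_d) (i : 'I_d) : 'cV[R]_d :=
  let e := basis_vec R i in (Num.sqrt (bform (hessian x) e e))^-1 *: e.

Definition conjmap (Phi s : 'M[R]_d) : 'M[R]_d := Phi *m s *m invmx Phi.

End Setting.

(* Main.v *)
From HB Require Import structures.
Require Import Defs.
From mathcomp Require Import all_boot all_order all_algebra finmap fraction.
From mathcomp Require mpoly.
From mathcomp Require Import classical_sets boolp functions reals topology normedtype.
From mathcomp Require Import derive landau ring.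

Import Order.TTheory GRing.Theory Num.Theory.
Import numFieldNormedType.Exports.
Local Open Scope classical_set_scope.
Local Open Scope ring_scope.
Import -(notations) mpoly.

Set Implicit Arguments.
Unset Strict Implicit.

(* Rational maps that are regular at x0 and fix x0 compose associatively, and the
   chain rule makes J multiplicative on them; G consists of such maps because its
   generators are involutions of this kind.
   Write L_i = A_i - x_i^-2 C_i for the i-th partial derivative of chi, which
   vanishes at x0.  The i-th coordinate of phi_i is x_i - (x_i / A_i) L_i, and the
   i-th diagonal entry of the Hessian B of chi at x0 is 2 A_i / x_i.  Hence J(phi_i)
   is the reflection along e_i for the scalar product B.  As Phi^T Phi = B,
   conjugation by Phi turns it into the Euclidean reflection along Phi e_i, a
   multiple of u_i.  Everything else follows by comparing generators. *)

(** * Values of rational functions *)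

(** As a ring morphism, [ratconst] can play the role of [phi] below, so that substituting a rational
    map becomes an instance of evaluating at a point. *)
HB.instance Definition _ (R : fieldType) (d : nat) :=
  GRing.RMorphism.copy (@ratconst R d) (@tofrac (mpoly d R) \o @mpolyC d R).

Section FieldFractions.
Variables (A : comNzRingType) (K : fieldType) (iota : {rmorphism A -> K}).

Lemma eq_morph_frac (p q p' q' : A) : iota q != 0 -> iota q' != 0 ->
  iota p / iota q = iota p' / iota q' -> iota (p * q') = iota (p' * q).
Proof. by move=> q0 q0' /eqP; rewrite eqr_div // !rmorphM => /eqP. Qed.

(** Serves both for [iota = tofrac] and for evaluation at a point: the same numerator and
    denominator then represent the sum in both fields. *)
Lemma add_morph_frac (p q p' q' : A) : iota q != 0 -> iota q' != 0 ->
  iota p / iota q + iota p' / iota q' = iota (p * q' + p' * q) / iota (q * q').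
Proof. by move=> q0 q0'; rewrite addf_div // rmorphD !rmorphM. Qed.

Lemma mul_morph_frac (p q p' q' : A) :
  iota p / iota q * (iota p' / iota q') = iota (p * p') / iota (q * q').
Proof. by rewrite mulf_div !rmorphM. Qed.

End FieldFractions.

Section RationalValues.
Variables (R : fieldType) (d : nat) (F : fieldType) (phi : {rmorphism R -> F}).
Implicit Types (y z t : 'rV[F]_d) (f k : ratfun R d) (p q : mpoly d R).
Implicit Types (g h : 'rV[ratfun R d]_d) (u v : F).

Lemma ratvalues_frac y p q : mmap phi (y 0) q != 0 ->
  ratvalues phi y (tofrac p / tofrac q) (mmap phi (y 0) p / mmap phi (y 0) q).
Proof. by move=> qy; exists p, q. Qed.

Lemma mmap_neq0 y q : mmap phi (y 0) q != 0 -> tofrac q != 0 :> ratfun R d.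
Proof. by rewrite tofrac_eq0; apply: contra_neq => ->; rewrite mmap0. Qed.

(** Two fractions representing [f] satisfy [p * q' = p' * q] already between polynomials, because
    [tofrac] is injective; evaluating this identity equates the values. *)
Lemma ratvalues_uniq y f u v :
  ratvalues phi y f u -> ratvalues phi y f v -> u = v.
Proof.
move=> [p [q [-> qy ->]]] [p' [q' [e qy' ->]]].
have e' := eq_morph_frac (mmap_neq0 qy) (mmap_neq0 qy') e.
apply/eqP; rewrite eqr_div // -!rmorphM /=; apply/eqP; congr (mmap _ _ _).
by apply/eqP; rewrite -tofrac_eq; apply/eqP.
Qed.

Lemma ratvalE y f v : ratvalues phi y f v -> ratval phi y f = v.
Proof.
by move=> fv; apply: xget_unique => // u fu; apply: ratvalues_uniq fu fv.
Qed.

(** The default value of [ratval] is 0, so a nonzero value certifies regularity. *)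
Lemma ratval_neq0 y f : ratval phi y f != 0 -> ratvalues phi y f (ratval phi y f).
Proof. by rewrite /ratval; case: xgetP => // _; rewrite eqxx. Qed.

Lemma ratvalues_poly y p : ratvalues phi y (tofrac p) (mmap phi (y 0) p).
Proof.
exists p, 1; rewrite rmorph1 divr1 /=.
by have -> : mmap phi (y 0) 1 = 1 by [rewrite rmorph1]; rewrite divr1 oner_neq0.
Qed.

Lemma ratvalues_const y c : ratvalues phi y (ratconst d c) (phi c).
Proof. by have := ratvalues_poly y (mpolyC d c); rewrite mmapC. Qed.

Lemma ratvaluesD y f k u v :
  ratvalues phi y f u -> ratvalues phi y k v -> ratvalues phi y (f + k) (u + v).
Proof.
move=> [p [q [-> qy ->]]] [p' [q' [-> qy' ->]]].
rewrite (add_morph_frac _ _ (mmap_neq0 qy) (mmap_neq0 qy')) add_morph_frac //.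
by apply: ratvalues_frac; rewrite rmorphM mulf_neq0.
Qed.

Lemma ratvaluesM y f k u v :
  ratvalues phi y f u -> ratvalues phi y k v -> ratvalues phi y (f * k) (u * v).
Proof.
move=> [p [q [-> qy ->]]] [p' [q' [-> qy' ->]]].
rewrite (mul_morph_frac (@tofrac _)) mul_morph_frac.
by apply: ratvalues_frac; rewrite rmorphM mulf_neq0.
Qed.

Lemma ratvaluesV y f v :
  v != 0 -> ratvalues phi y f v -> ratvalues phi y f^-1 v^-1.
Proof.
move=> v0 [p [q [-> qy vE]]].
exists q, p; rewrite vE !invf_div; split=> //.
by apply: contra_neq v0 => p0; rewrite vE p0 mul0r.
Qed.

Lemma ratvalues0 y : ratvalues phi y 0 0.
Proof. by have := ratvalues_const y 0; rewrite !rmorph0. Qed.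

Lemma ratvalues1 y : ratvalues phi y 1 1.
Proof. by have := ratvalues_const y 1; rewrite !rmorph1. Qed.

Lemma ratvalues_sum (I : Type) (r : seq I) (P : pred I) y
    (f : I -> ratfun R d) (v : I -> F) :
  (forall i, ratvalues phi y (f i) (v i)) ->
  ratvalues phi y (\sum_(i <- r | P i) f i) (\sum_(i <- r | P i) v i).
Proof.
move=> fv; elim/big_ind2: _ => [|f1 f2 v1 v2|//]; first exact: ratvalues0.
exact: ratvaluesD.
Qed.

Lemma ratvalues_prod (I : Type) (r : seq I) (P : pred I) y
    (f : I -> ratfun R d) (v : I -> F) :
  (forall i, ratvalues phi y (f i) (v i)) ->
  ratvalues phi y (\prod_(i <- r | P i) f i) (\prod_(i <- r | P i) v i).
Proof.
move=> fv; elim/big_ind2: _ => [|f1 f2 v1 v2|//]; first exact: ratvalues1.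
exact: ratvaluesM.
Qed.

Lemma ratvaluesXn y f v n : ratvalues phi y f v -> ratvalues phi y (f ^+ n) (v ^+ n).
Proof.
move=> fv; elim: n => [|n IH]; first exact: ratvalues1.
by rewrite !exprS; apply: ratvaluesM.
Qed.

Lemma ratvaluesXz y f v (n : int) :
  v != 0 -> ratvalues phi y f v -> ratvalues phi y (f ^ n) (v ^ n).
Proof.
move=> v0 fv; case: n => n; first exact: ratvaluesXn.
by apply: ratvaluesV; rewrite ?expf_neq0 //; apply: ratvaluesXn.
Qed.

(** A relation rather than a function: it includes the regularity of [g] at [y], which [ratmap_eval]
    hides behind default values. *)
Definition ratmap_at y g z := forall j, ratvalues phi y (g 0 j) (z 0 j).

Lemma ratmap_evalE y g z : ratmap_at y g z -> ratmap_eval phi y g = z.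
Proof. by move=> gz; apply/rowP => j; rewrite mxE; apply: ratvalE. Qed.

Lemma ratmap_at_generic y : ratmap_at y (generic_point R d) y.
Proof.
move=> j; rewrite mxE.
by have := ratvalues_poly y (mpolyX R (mnm1 j)); rewrite mmapX mmap1U.
Qed.

Lemma ratvalues_mmap y h z p : ratmap_at y h z ->
  ratvalues phi y (mmap (@ratconst R d) (h 0) p) (mmap phi (z 0) p).
Proof.
move=> hz; apply: ratvalues_sum => m; apply: ratvaluesM; first exact: ratvalues_const.
by apply: ratvalues_prod => i; apply: ratvaluesXn.
Qed.

End RationalValues.

(** * Composition of rational maps and maps regular at a fixed point *)

Section Composition.
Variables (R : fieldType) (d : nat).
Local Notation K := (ratfun R d).
Local Notation cst := (@ratconst R d).
Local Notation X := (generic_point R d).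
Local Notation comp := (@ratmap_comp R d).
Implicit Types (f : K) (g h k : 'rV[K]_d).

Section Regular.
Variables (F : fieldType) (phi : {rmorphism R -> F}).
Implicit Types (y z t : 'rV[F]_d).

(** If substituting [h] turned the denominator [q] into the zero function, its value at [y] would be
    both 0 and the nonzero [q(z)]. So regularity at the single point [z] makes the composite a
    genuine substitution. *)
Lemma ratvalues_regular y h z f v : ratmap_at phi y h z -> ratvalues phi z f v ->
  ratvalues cst h f (ratval cst h f) /\ ratvalues phi y (ratval cst h f) v.
Proof.
move=> hz [p [q [-> qz ->]]].
have pv := ratvalues_mmap p hz; have qv := ratvalues_mmap q hz.
have qh : mmap cst (h 0) q != 0.
  apply: contra_neq qz => q0; rewrite q0 in qv.
  exact: ratvalues_uniq qv (ratvalues0 _ _).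
have := ratvalues_frac p qh => fv.
by rewrite (ratvalE fv); split=> //; apply: ratvaluesM => //; apply: ratvaluesV.
Qed.

Lemma ratmap_at_regular y h z g t :
  ratmap_at phi y h z -> ratmap_at phi z g t -> ratmap_at cst h g (comp g h).
Proof.
by move=> hz gt j; rewrite mxE; have [] := ratvalues_regular hz (gt j).
Qed.

Lemma ratmap_at_comp y h z g t :
  ratmap_at phi y h z -> ratmap_at phi z g t -> ratmap_at phi y (comp g h) t.
Proof.
by move=> hz gt j; rewrite mxE; have [] := ratvalues_regular hz (gt j).
Qed.

(** Substituting the generic point in a polynomial [p] gives [tofrac p], so a fraction usable at [y]
    is also usable at the generic point. *)
Lemma ratmap_at_generic_point y g t : ratmap_at phi y g t -> ratmap_at cst X g g.
Proof.
have mmapX p : mmap cst (X 0) p = tofrac p.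
  rewrite [p in RHS]mpolyE rmorph_sum; apply: eq_bigr => m _ /=.
  rewrite -mul_mpolyC rmorphM mpolyXE_id rmorph_prod /=; congr (_ * _).
  by apply: eq_bigr => i _; rewrite mxE rmorphXn.
move=> gt j; have [p [q [-> qy _]]] := gt j.
by exists p, q; rewrite !mmapX (mmap_neq0 qy).
Qed.

End Regular.

Lemma generic_point_neq0 j : X 0 j != 0.
Proof.
rewrite mxE tofrac_eq0; apply/eqP => /(congr1 (mcoeff (mnm1 j))).
by rewrite mcoeffX eqxx mcoeff0 => /eqP; rewrite oner_eq0.
Qed.

Lemma comp1_ratmap h : comp X h = h.
Proof. by apply: ratmap_evalE; apply: ratmap_at_generic. Qed.

(* Composition is not associative in general, because of the junk value [0] of
   [ratval] at the points where a rational function is not regular. *)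
Lemma ratmap_compA g h k :
  ratmap_at cst k h (comp h k) -> ratmap_at cst (comp h k) g (comp g (comp h k)) ->
  comp (comp g h) k = comp g (comp h k).
Proof. by move=> hk gk; apply: ratmap_evalE; apply: ratmap_at_comp gk. Qed.

(* The coordinates of the generic point are nonzero, hence not junk values. *)
Lemma comp_generic_regular g h : comp g h = X -> ratmap_at cst h g X.
Proof.
move=> e j; have ej : ratval cst h (g 0 j) = X 0 j.
  by have := congr1 (fun M : 'rV_d => M 0 j) e; rewrite mxE.
rewrite -ej; apply: ratval_neq0; rewrite ej; exact: generic_point_neq0.
Qed.

(** The usual computation [h = h (g k) = (h g) k = k]; its associativity is legitimate because a
    composite equal to the generic point forces regularity. It identifies an inverse about which
    nothing is known at [x] with one that fixes [x]. *)
Lemma ratmap_inv_uniq g h k : comp g h = X -> comp h g = X ->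
  comp g k = X -> h = k.
Proof.
move=> gh hg gk.
have hgX := comp_generic_regular hg; have gkX := comp_generic_regular gk.
have hX := ratmap_at_generic_point hgX.
have hX1 : comp h X = h := ratmap_evalE hX.
by rewrite -hX1 -gk -ratmap_compA ?gk ?hg ?comp1_ratmap ?hX1.
Qed.

Section FixedPoint.
Variable x : 'rV[R]_d.

Definition fixes g := ratmap_at idfun x g x.

Lemma fixes_comp g h : fixes g -> fixes h -> fixes (comp g h).
Proof. by move=> gx hx; apply: ratmap_at_comp hx gx. Qed.

Lemma fixes_compA g h k : fixes g -> fixes h -> fixes k ->
  comp (comp g h) k = comp g (comp h k).
Proof.
move=> gx hx kx; apply: ratmap_compA; first exact: ratmap_at_regular kx hx.
exact: ratmap_at_regular (fixes_comp hx kx) gx.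
Qed.

(** The induction carries an inverse fixing [x], since regularity of a map says nothing by itself
    about its inverse. An inverse introduced by [generated_inv] must coincide with the carried
    one. *)
Lemma generated_fixes (A : set 'rV[K]_d) :
  (forall g, A g -> fixes g /\ comp g g = X) ->
  forall g, generated comp X A g -> fixes g /\
    exists h, [/\ generated comp X A h, fixes h, comp g h = X & comp h g = X].
Proof.
move=> Afix g; elim=> {g} [g Ag||g1 g2 G1 [f1 [h1 [H1 fh1 e1 e1']]]
    G2 [f2 [h2 [H2 fh2 e2 e2']]]|g h Gg [fg [k [Hk fk e1 e2]]] gh hg].
- have [fg gg] := Afix _ Ag; split=> //; exists g; split=> //; exact: generated_in.
- split; first exact: ratmap_at_generic.
  exists X; split; [exact: generated_unit | exact: ratmap_at_generic | |];
    exact: comp1_ratmap.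
- have fg := fixes_comp f1 f2; have fh := fixes_comp fh2 fh1.
  split; first exact: fg.
  exists (comp h2 h1); split; [exact: generated_op H2 H1 | exact: fh | |].
    rewrite (fixes_compA f1 f2 fh) -(fixes_compA f2 fh2 fh1) e2 comp1_ratmap.
    exact: e1.
  rewrite (fixes_compA fh2 fh1 fg) -(fixes_compA fh1 f1 f2) e1' comp1_ratmap.
  exact: e2'.
- have -> : h = k := ratmap_inv_uniq gh hg e1.
  split; first exact: fk.
  by exists g; split; [exact: Gg | exact: fg | exact: e2 | exact: e1].
Qed.

End FixedPoint.

End Composition.

(** * The generators of the combinatorial group are involutions *)

Section Involution.
Variables (R : fieldType) (d : nat) (S : {fset 'rV[int]_d}) (w : 'rV[int]_d -> R).
Implicit Types (i j : 'I_d) (e : int).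
Local Notation X := (generic_point R d).

Section Values.
Variables (F : fieldType) (phi : {rmorphism R -> F}).
Implicit Types (y z : 'rV[F]_d) (h : 'rV[ratfun R d]_d).

(** Defined over any field, so that one formula gives both the values at real points and, at the
    generic point, the rational map itself. *)
Definition involution_at i y : 'rV[F]_d :=
  \row_j (if j == i
          then (y 0 i)^-1 * (inventory_coef phi S w i 1%R y)^-1
               * inventory_coef phi S w i (-1) y
          else y 0 j).

Lemma eq_inventory_coef i e y z : (forall j, j != i -> y 0 j = z 0 j) ->
  inventory_coef phi S w i e y = inventory_coef phi S w i e z.
Proof.
move=> yz; apply: eq_bigr => s _; congr (_ * _).
by apply: eq_bigr => j /yz ->.
Qed.

Lemma ratvalues_inventory_coef i e y h z :
  ratmap_at phi y h z -> (forall j, z 0 j != 0) ->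
  ratvalues phi y (inventory_coef (@ratconst R d) S w i e h)
                  (inventory_coef phi S w i e z).
Proof.
move=> hz z0; apply: ratvalues_sum => s; apply: ratvaluesM.
  exact: ratvalues_const.
by apply: ratvalues_prod => j; apply: ratvaluesXz.
Qed.

Lemma ratmap_at_involution i y : (forall j, y 0 j != 0) ->
  inventory_coef phi S w i 1 y != 0 ->
  ratmap_at phi y (involution_gen S w i) (involution_at i y).
Proof.
move=> y0 A0 j; rewrite [involution_gen _ _ _ _ _]mxE [involution_at _ _ _ _]mxE.
case: eqP => _; last exact: ratmap_at_generic.
rewrite -mulrA [_^-1 * inventory_coef phi _ _ _ _ _]mulrC.
have Xy := @ratmap_at_generic _ _ _ phi y.
apply: ratvaluesM; first by apply: ratvaluesV; [exact: y0 | exact: Xy].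
apply: ratvaluesM; first exact: ratvalues_inventory_coef.
by apply: ratvaluesV A0 _; apply: ratvalues_inventory_coef.
Qed.

Lemma involution_at_id i j y : j != i -> involution_at i y 0 j = y 0 j.
Proof. by rewrite mxE => /negbTE ->. Qed.

(** [A_i] and [C_i] do not see the i-th coordinate, so [t -> C / (A t)] is applied twice with the
    same constants. *)
Lemma involution_atK i y : y 0 i != 0 ->
  inventory_coef phi S w i 1 y != 0 -> inventory_coef phi S w i (-1) y != 0 ->
  involution_at i (involution_at i y) = y.
Proof.
move=> y0 A0 C0; apply/rowP => j.
have [->|ji] := eqVneq j i; last by rewrite !involution_at_id.
rewrite mxE eqxx !(eq_inventory_coef _ (fun j => @involution_at_id i j y)).
by rewrite mxE eqxx; field; rewrite y0 A0 C0.
Qed.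

End Values.

Lemma involution_genE i :
  involution_gen S w i = involution_at (@ratconst R d) i X.
Proof.
apply/rowP => j; rewrite [LHS]mxE [RHS]mxE.
by case: eqP => // _; rewrite -mulrA [X in _ * X]mulrC.
Qed.

(** The point [y] shows that [A_i] and [C_i] are nonzero rational functions; the pointwise
    involution is then applied at the generic point. *)
Lemma involution_gen_involutive i (y : 'rV[R]_d) : (forall j, y 0 j != 0) ->
  inventory_coef idfun S w i 1 y != 0 -> inventory_coef idfun S w i (-1) y != 0 ->
  ratmap_comp (involution_gen S w i) (involution_gen S w i) = X.
Proof.
move=> y0 Ay Cy; have Xy := @ratmap_at_generic _ _ _ idfun y.
have nz e : inventory_coef idfun S w i e y != 0 ->
    inventory_coef (@ratconst R d) S w i e X != 0.
  apply: contra_neq => A0.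
  have := ratvalues_inventory_coef i e Xy y0; rewrite A0 => Av.
  exact: ratvalues_uniq Av (ratvalues0 _ _).
have A0 := nz _ Ay; have C0 := nz _ Cy; have X0 := @generic_point_neq0 R d.
rewrite -[RHS](involution_atK (X0 i) A0 C0) -involution_genE.
(* What remains is regularity of the involution at its own value on the generic point: nonzero
   coordinates, and [A_i] nonzero there, which holds because [A_i] ignores [x_i]. *)
apply: ratmap_evalE; apply: ratmap_at_involution; last first.
  rewrite involution_genE (@eq_inventory_coef _ _ i 1 _ X); first exact: A0.
  by move=> j ji; apply: involution_at_id.
move=> j; have [->|ji] := eqVneq j i; last first.
  by rewrite involution_genE (involution_at_id _ _ ji); exact: X0.
rewrite involution_genE mxE eqxx.
apply: mulf_neq0; last exact: C0.
by apply: mulf_neq0; apply: invr_neq0; [exact: X0 | exact: A0].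
Qed.

End Involution.

(** * Differentiability of sums, products, powers and locally equal functions *)

Section Differentiability.
Variables (R : realType) (V : normedModType R).
Implicit Types (x v : V).

Lemma differentiable_big_sum (I : Type) (r : seq I) (P : pred I) (f : I -> V -> R) x :
  (forall i, differentiable (f i) x) ->
  differentiable (fun y => \sum_(i <- r | P i) f i y) x.
Proof.
move=> fx; have -> : (fun y => \sum_(i <- r | P i) f i y) = \sum_(i <- r | P i) f i.
  by apply/funext => y; rewrite fct_sumE.
by elim/big_ind: _ => [|f1 f2|i _]; [exact: differentiable_cst | exact: differentiableD |].
Qed.

Lemma differentiable_big_prod (I : Type) (r : seq I) (P : pred I) (f : I -> V -> R) x :
  (forall i, differentiable (f i) x) ->
  differentiable (fun y => \prod_(i <- r | P i) f i y) x.
Proof.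
move=> fx; have -> : (fun y => \prod_(i <- r | P i) f i y) = \prod_(i <- r | P i) f i.
  by apply/funext => y; rewrite fct_prodE.
by elim/big_ind: _ => [|f1 f2|i _]; [exact: differentiable_cst | exact: differentiableM |].
Qed.

Lemma differentiable_exprn (f : V -> R) n x :
  differentiable f x -> differentiable (fun y => f y ^+ n) x.
Proof.
move=> fx; case: n => [|n]; first exact: differentiable_cst.
have := @differentiableX R V f n x fx.
by congr (differentiable _ _); apply/funext => y; rewrite exprfctE.
Qed.

Lemma differentiable_exprz (f : V -> R) (n : int) x : f x != 0 ->
  differentiable f x -> differentiable (fun y => f y ^ n) x.
Proof.
move=> f0 fx; case: n => n; first exact: differentiable_exprn.
by apply: differentiableV; rewrite ?expf_neq0 //; apply: differentiable_exprn.
Qed.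

Lemma differentiable_rowP n (f : V -> 'rV[R]_n) x :
  (forall j, differentiable (fun y => f y 0 j) x) -> differentiable f x.
Proof.
move=> fx.
have -> : f = \sum_(j < n) (fun y => f y 0 j *: (delta_mx 0 j : 'rV[R]_n)).
  by apply/funext => y; rewrite fct_sumE -row_sum_delta.
by apply: differentiable_sum => j; apply: differentiableZl.
Qed.

(** The difference [g - f] vanishes near [x], hence is differentiable there with zero differential;
    adding it to [f] gives [g]. *)
Lemma near_eq_differentiable (W : normedModType R) (f g : V -> W) x :
  {near x, f =1 g} -> differentiable f x -> differentiable g x.
Proof.
move=> fg fx; pose k := g - f.
have k0 : \forall y \near x, k y = 0.
  by apply: filterS fg => y fy; rewrite -[k y]/(g y - f y) fy subrr.
suff kx : differentiable k x.
  by have := differentiableD fx kx; rewrite /k addrC subrK.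
have ko : k \o shift x = cst (k x) + (\0 : {linear V -> W}) +o_ 0 id.
  apply/eqaddoP => e e0.
  rewrite (nbhs_singleton k0).
  have : \forall h \near 0, k (h + x) = 0 by move: k0; rewrite (near_shift 0) subr0.
  by apply: filterS => h /= kh; rewrite !fctE /= kh addr0 subr0 normr0 mulr_ge0 // ltW.
apply/diff_locallyP.
have c0 : continuous (\0 : {linear V -> W}) by move=> y; apply: cst_continuous.
by rewrite (diff_unique c0 ko).
Qed.

Lemma near_differentiable_neq0 (f : V -> R) x :
  differentiable f x -> f x != 0 -> \forall y \near x, f y != 0.
Proof. by move=> /differentiable_continuous fx; apply: cvgr_neq0. Qed.

End Differentiability.

(** * Jacobian matrices of rational maps and the chain rule *)

Section Jacobian.
Variables (R : realType) (d : nat).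
Implicit Types (x y z v : 'rV[R]_d) (g h : 'rV[ratfun R d]_d).

Lemma jacobianP n (f : 'rV[R]_d -> 'rV[R]_n) x (M : 'M[R]_(d, n)) :
  differentiable f x -> (forall v, 'D_v f x = v *m M) -> 'J f x = M.
Proof.
by move=> fx fM; apply/row_matrixP => i; rewrite !rowE -deriveEjacobian.
Qed.

Lemma derive_coord v x j : 'D_v (fun y => y 0 j) x = v 0 j.
Proof.
have := derive_mx (@derivable_id _ _ x v).
by rewrite derive_id => /(congr1 (fun M : 'rV_d => M 0 j)) ->; rewrite mxE.
Qed.

Lemma near_coord_neq0 x : (forall j, x 0 j != 0) ->
  \forall y \near x, forall j, (y : 'rV[R]_d) 0 j != 0.
Proof.
move=> x0; apply: (@filter_forall _ _ (fun j (y : 'rV[R]_d) => y 0 j != 0) _ (nbhs_filter x)) => j.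
apply: (@near_differentiable_neq0 _ _ (fun y : 'rV[R]_d => y 0 j)) (x0 j).
exact: differentiable_coord.
Qed.

Lemma differentiable_mmap (p : mpoly d R) x :
  differentiable (fun y => mmap idfun (y 0) p) x.
Proof.
apply: differentiable_big_sum => m; apply: differentiableM.
  exact: differentiable_cst.
apply: differentiable_big_prod => i; apply: differentiable_exprn.
exact: differentiable_coord.
Qed.

(** By continuity the denominator of one representing fraction stays nonzero near [x], so this
    fraction computes [f] on a whole neighbourhood. *)
Lemma ratvalues_near x (f : ratfun R d) u : ratvalues idfun x f u ->
  (\forall y \near x, ratvalues idfun y f (ratval idfun y f)) /\
  differentiable (fun y => ratval idfun y f) x.
Proof.
move=> [p [q [-> qx _]]].
have near_q := near_differentiable_neq0 (differentiable_mmap q x) qx.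
split.
  apply: filterS near_q => y qy.
  by have fy := ratvalues_frac p qy; rewrite (ratvalE fy).
apply: (@near_eq_differentiable _ _ _
  (fun y => mmap idfun (y 0) p * (mmap idfun (y 0) q)^-1)).
  by apply: filterS near_q => y qy; rewrite (ratvalE (ratvalues_frac p qy)).
apply: differentiableM; first exact: differentiable_mmap.
by apply: differentiableV qx; apply: differentiable_mmap.
Qed.

Lemma ratmap_at_near x g z : ratmap_at idfun x g z ->
  \forall y \near x, ratmap_at idfun y g (ratmap_eval idfun y g).
Proof.
move=> gx; apply: (@filter_forall _ _ (fun j (y : 'rV[R]_d) =>
  ratvalues idfun y (g 0 j) (ratmap_eval idfun y g 0 j)) _ (nbhs_filter x)) => j.
by apply: filterS (ratvalues_near (gx j)).1 => y; rewrite mxE.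
Qed.

Lemma differentiable_ratmap x g z : ratmap_at idfun x g z ->
  differentiable (fun y => ratmap_eval idfun y g) x.
Proof.
move=> gx; apply: differentiable_rowP => j.
have -> : (fun y => ratmap_eval idfun y g 0 j) = (fun y => ratval idfun y (g 0 j)).
  by apply/funext => y; rewrite mxE.
exact: (ratvalues_near (gx j)).2.
Qed.

Lemma jacE x g z i j : ratmap_at idfun x g z ->
  jac x g i j = 'D_(delta_mx 0 j) (fun y => ratval idfun y (g 0 i)) x.
Proof.
move=> gx; have dg := differentiable_ratmap gx.
have <- : row j ('J (fun y => ratmap_eval idfun y g) x) 0 i = jac x g i j.
  by rewrite !mxE.
rewrite rowE -deriveEjacobian // derive_mx; last exact: diff_derivable.
have -> : (fun y => ratval idfun y (g 0 i)) = (fun y => ratmap_eval idfun y g 0 i).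
  by apply/funext => y; rewrite mxE.
by rewrite mxE.
Qed.

Lemma jac_generic_point x : jac x (generic_point R d) = 1%:M.
Proof.
rewrite /jac; have -> : (fun y => ratmap_eval idfun y (generic_point R d)) = id.
  by apply/funext => y; apply: ratmap_evalE; apply: ratmap_at_generic.
rewrite (@jacobianP _ _ _ 1%:M) ?trmx1 // => v.
by rewrite derive_id mulmx1.
Qed.

Lemma jac_comp x g h z t : ratmap_at idfun x h z -> ratmap_at idfun z g t ->
  jac x (ratmap_comp g h) = jac z g *m jac x h.
Proof.
(* ['J] acts on row vectors, where a composite multiplies in the opposite order. *)
move=> hx gz; rewrite -trmx_mul; congr (_^T).
have dh := differentiable_ratmap hx; have dg := differentiable_ratmap gz.
have hxE := ratmap_evalE hx.
have dg' : differentiable (fun y => ratmap_eval idfun y g) (ratmap_eval idfun x h).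
  by rewrite hxE.
apply: jacobianP; first exact: differentiable_ratmap (ratmap_at_comp hx gz).
move=> v; rewrite -(near_eq_derive
  (f := (fun y => ratmap_eval idfun y g) \o (fun y => ratmap_eval idfun y h))).
  rewrite deriveE; last exact: differentiable_comp.
  by rewrite diff_comp //= hxE mulmxA !mul_rV_lin1.
(* Evaluating the composite map agrees with composing the evaluations wherever both maps are
   regular; continuity of [h] makes this hold near [x]. *)
have g_near := ratmap_at_near gz; rewrite -hxE in g_near.
have := differentiable_continuous dh g_near.
apply: filterS2 (ratmap_at_near hx) => y hy gy.
by rewrite /= (ratmap_evalE (ratmap_at_comp hy gy)).
Qed.

End Jacobian.

(** * The Jacobian matrices of the involutions *)

Section CriticalPoint.
Variables (R : realType) (d : nat) (S : {fset 'rV[int]_d}) (w : 'rV[int]_d -> R).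
Hypothesis S_small : small_steps S.
Implicit Types (x y v : 'rV[R]_d) (i j k : 'I_d) (e : int).
Local Notation coef := (inventory_coef idfun S w).

Lemma differentiable_inventory_coef i e x : (forall j, x 0 j != 0) ->
  differentiable (coef i e) x.
Proof.
move=> x0; apply: differentiable_big_sum => s; apply: differentiableM.
  exact: differentiable_cst.
apply: differentiable_big_prod => j; apply: differentiable_exprz (x0 j) _.
exact: differentiable_coord.
Qed.

(** The coefficient does not involve [x_i], so the difference quotient is identically zero. *)
Lemma derive_inventory_coef i e x : 'D_(delta_mx 0 i) (coef i e) x = 0.
Proof.
rewrite /derive; apply: cvg_lim => //.
have -> : (fun h => h^-1 *: ((coef i e \o shift x) (h *: delta_mx 0 i) - coef i e x))
          = fun=> 0.
  apply/funext => h /=; rewrite (@eq_inventory_coef _ _ _ _ _ _ i e _ x) ?subrr ?scaler0 //.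
  by move=> j /negbTE ji; rewrite !mxE eqxx ji mulr0 add0r.
exact: cvg_cst.
Qed.

(** Closed form [L_i = A_i - x_i^-2 C_i] of the i-th partial derivative of [chi]. *)
Definition chi_slope i y : R := coef i 1 y - (y 0 i)^-1 ^+ 2 * coef i (-1) y.

Lemma derive_coordV i v x : x 0 i != 0 ->
  'D_v (fun y => (y 0 i)^-1) x = - (x 0 i)^-1 ^+ 2 * v 0 i.
Proof.
move=> x0; rewrite deriveV ?derive_coord ?exprVn //.
by apply: diff_derivable; apply: differentiable_coord.
Qed.

Lemma partial_chi i x : (forall j, x 0 j != 0) ->
  partial i (chi S w) x = chi_slope i x.
Proof.
move=> x0; rewrite /partial.
have dc := @differentiable_coord _ _ _ x 0 i.
have dA := differentiable_inventory_coef i 1 x0.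
have dB := differentiable_inventory_coef i 0 x0.
have dC := differentiable_inventory_coef i (-1) x0.
have dV := differentiableV dc (x0 i).
(* Where [x_i] is nonzero, hence near [x], [chi] is [x_i A_i + B_i + x_i^-1 C_i]. *)
rewrite -(near_eq_derive (f := (fun y => y 0 i) * coef i 1 + coef i 0
    + (fun y => (y 0 i)^-1) * coef i (-1))); last first.
  apply: filterS (near_coord_neq0 x0) => y y0.
  exact/esym/(inventory_split idfun w S_small (y0 i)).
have dcA := differentiableM dc dA; have dVC := differentiableM dV dC.
have D (f : 'rV[R]_d -> R) : differentiable f x -> derivable f x (delta_mx 0 i).
  by move=> fx; apply: diff_derivable.
rewrite (deriveD (D _ (differentiableD dcA dB)) (D _ dVC)) (deriveD (D _ dcA) (D _ dB)).
rewrite (deriveM (D _ dc) (D _ dA)) (deriveM (D _ dV) (D _ dC)).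
rewrite !derive_inventory_coef derive_coord derive_coordV // !scaler0 !mxE !eqxx.
by rewrite /chi_slope !add0r addr0 /GRing.scale /= !mulr1 mulrN [_ * coef _ _ _]mulrC.
Qed.

Lemma differentiable_chi_slope i x : (forall j, x 0 j != 0) ->
  differentiable (chi_slope i) x.
Proof.
move=> x0; apply: differentiableB; first exact: differentiable_inventory_coef.
apply: differentiableM; last exact: differentiable_inventory_coef.
apply: differentiable_exprn; apply: differentiableV (x0 i).
exact: differentiable_coord.
Qed.

Lemma hessian_chi i j x : (forall k, x 0 k != 0) ->
  hessian S w x i j = 'D_(delta_mx 0 i) (chi_slope j) x.
Proof.
move=> x0; rewrite mxE; apply: near_eq_derive.
by apply: filterS (near_coord_neq0 x0) => y y0; apply: partial_chi.
Qed.

(** Of the two terms of [chi_slope i], only [x_i^-2 C_i] varies with [x_i]. *)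
Lemma hessian_chi_diag i x : (forall k, x 0 k != 0) ->
  hessian S w x i i = 2 * (x 0 i)^-1 ^+ 3 * coef i (-1) x.
Proof.
move=> x0; rewrite hessian_chi //.
have dV := differentiableV (@differentiable_coord _ _ _ x 0 i) (x0 i).
have dA := differentiable_inventory_coef i 1 x0.
have dC := differentiable_inventory_coef i (-1) x0.
have D (f : 'rV[R]_d -> R) : differentiable f x -> derivable f x (delta_mx 0 i).
  by move=> fx; apply: diff_derivable.
pose V y := (y 0 i)^-1 : R.
have -> : chi_slope i = coef i 1 - V * V * coef i (-1).
  by apply/funext => y; rewrite /chi_slope expr2.
have dVV := differentiableM dV dV.
rewrite (deriveB (D _ dA) (D _ (differentiableM dVV dC))).
rewrite (deriveM (D _ dVV) (D _ dC)) (deriveM (D _ dV) (D _ dV)).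
rewrite !derive_inventory_coef derive_coordV // !mxE !eqxx /GRing.scale /= /V.
ring.
Qed.

(** Only the i-th coordinate moves, hence a correction of rank one. Its row is the gradient of
    [L_i]; symmetry of the Hessian will later turn it into [e_i^T B]. *)
Lemma jac_involution i x (A0 : coef i 1 x != 0) : (forall k, x 0 k != 0) ->
  chi_slope i x = 0 ->
  jac x (involution_gen S w i) =
  1%:M - (x 0 i / coef i 1 x) *: (delta_mx i 0 *m (\row_j hessian S w x j i)).
Proof.
move=> x0 crit; have at_phi := @ratmap_at_involution _ _ S w _ idfun i x x0 A0.
apply/matrixP => k j; rewrite (jacE _ _ at_phi).
have dc l := @differentiable_coord _ _ _ x 0 l.
have dA := differentiable_inventory_coef i 1 x0.
have dVA := differentiableM (dc i) (differentiableV dA A0).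
have dL := differentiable_chi_slope i x0.
have D (f : 'rV[R]_d -> R) : differentiable f x -> derivable f x (delta_mx 0 j).
  by move=> fx; apply: diff_derivable.
have near_phi : \forall y \near x, ratmap_eval idfun y (involution_gen S w i)
    = involution_at S w idfun i y.
  apply: filterS2 (near_coord_neq0 x0) (near_differentiable_neq0 dA A0) => y y0 Ay.
  by apply: ratmap_evalE; apply: ratmap_at_involution.
have near_k : \forall y \near x,
    involution_at S w idfun i y 0 k = ratval idfun y (involution_gen S w i 0 k).
  by apply: filterS near_phi => y <-; rewrite mxE.
rewrite -(near_eq_derive _ near_k).
transitivity ((k == j)%:R - x 0 i / coef i 1 x * ((k == i)%:R * hessian S w x j i));
  last by rewrite !mxE big_ord1 !mxE eqxx andbT.
have [->|ki] := eqVneq k i; last first.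
  rewrite mul0r mulr0 subr0.
  have -> : (fun y => involution_at S w idfun i y 0 k) = (fun y => y 0 k).
    by apply/funext => y; rewrite involution_at_id.
  by rewrite derive_coord mxE eqxx.
(* x_i^-1 C_i / A_i = x_i - (x_i / A_i) (A_i - x_i^-2 C_i), where the second
   product has a factor vanishing at [x]. *)
pose c (y : 'rV[R]_d) := y 0 i.
pose q (y : 'rV[R]_d) := y 0 i * (coef i 1 y)^-1.
rewrite -(near_eq_derive (f := c - q * chi_slope i)); last first.
  apply: filterS2 (near_coord_neq0 x0) (near_differentiable_neq0 dA A0) => y y0 Ay.
  rewrite mxE eqxx -[LHS]/(c y - q y * chi_slope i y) /c /q /chi_slope.
  by field; rewrite Ay y0.
rewrite (deriveB (D _ (dc i)) (D _ (differentiableM dVA dL))).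
rewrite (deriveM (D _ dVA) (D _ dL)) crit scale0r addr0 derive_coord mxE eqxx /=.
by rewrite -hessian_chi // mul1r.
Qed.

End CriticalPoint.

(** * Reflections *)

Section Generated.
Variables (T U : Type) (opT : T -> T -> T) (eT : T) (opU : U -> U -> U) (eU : U).

Lemma generated_morphism (f : T -> U) (A : set T) :
  (forall x y, f (opT x y) = opU (f x) (f y)) -> f eT = eU ->
  forall x, generated opT eT A x -> generated opU eU (f @` A) (f x).
Proof.
move=> fM f1 x; elim=> {x} [x Ax||x y _ Fx _ Fy|x y _ Fx xy yx].
- by apply: generated_in; exists x.
- by rewrite f1; apply: generated_unit.
- by rewrite fM; apply: generated_op.
- by apply: generated_inv Fx _ _; rewrite -fM ?xy ?yx.
Qed.

End Generated.

Section LinearAlgebra.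
Variables (R : realType) (d : nat).
Implicit Types (A B D M N P : 'M[R]_d) (u v : 'cV[R]_d) (a : 'rV[R]_d).

Lemma bform_basis B i j : bform B (basis_vec R i) (basis_vec R j) = B i j.
Proof. by rewrite bformE /basis_vec trmx_delta -rowE -colE !mxE. Qed.

(** A nonzero vector of the left kernel would give the form the value 0. *)
Lemma posdefmx_unit M : posdefmx M -> M \in unitmx.
Proof.
move=> [Msym Mpos]; rewrite -row_free_unit -kermx_eq0; apply: contraT => K0.
have := Mpos (nz_row (kermx M))^T.
have uM : nz_row (kermx M) *m M = 0 by apply/sub_kermxP; apply: nz_row_sub.
rewrite bformE trmxK uM mul0mx mxE ltxx -{1}trmx0 (inj_eq trmx_inj) nz_row_eq0.
by move=> /(_ K0).
Qed.

Lemma reflection_scale B v (c : R) : c != 0 -> reflection B (c *: v) = reflection B v.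
Proof.
move=> c0; have vT : (c *: v)^T = c *: v^T by rewrite linearZ.
have vBv : bform B (c *: v) (c *: v) = c * c * bform B v v.
  by rewrite !bformE vT -!scalemxAl -scalemxAr scalerA mxE.
rewrite /reflection vBv vT -scalemxAr -!scalemxAl !scalerA.
(* Generalizing the inverse also covers the case where [bform B v v] is 0. *)
congr (_ - _ *: _); rewrite invfM; move: (bform B v v)^-1 => b.
by field.
Qed.

Lemma conjmapM P M N : P \in unitmx ->
  conjmap P (M *m N) = conjmap P M *m conjmap P N.
Proof. by move=> Pu; rewrite /conjmap !mulmxA mulmxKV. Qed.

Lemma conjmap1 P : P \in unitmx -> conjmap P 1%:M = 1%:M.
Proof. by move=> Pu; rewrite /conjmap mulmx1 mulmxV. Qed.

Lemma conjmapK P M : P \in unitmx -> conjmap (invmx P) (conjmap P M) = M.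
Proof. by move=> Pu; rewrite /conjmap invmxK !mulmxA mulVmx // mul1mx mulmxKV. Qed.

(** One inclusion holds for any morphism; the other is the same inclusion for conjugation by
    [invmx P]. *)
Lemma conjmap_mxgroup P (A : set 'M[R]_d) : P \in unitmx ->
  conjmap P @` mxgroup A = mxgroup (conjmap P @` A).
Proof.
move=> Pu; have iPu : invmx P \in unitmx by rewrite unitmx_inv.
have M1 := fun M N => conjmapM M N Pu; have M2 := fun M N => conjmapM M N iPu.
apply/seteqP; split=> [_ [M AM <-]|M AM].
  exact: generated_morphism M1 (conjmap1 Pu) _ AM.
exists (conjmap (invmx P) M); last first.
  by have := conjmapK M iPu; rewrite invmxK.
have AK : conjmap (invmx P) @` (conjmap P @` A) = A.
  apply/seteqP; split=> [_ [_ [N AN <-] <-]|N AN]; first by rewrite conjmapK.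
  by exists (conjmap P N); [exists N | exact: conjmapK].
by have := generated_morphism M2 (conjmap1 iPu) AM; rewrite AK.
Qed.

Lemma conjmap_reflection B P v : P \in unitmx -> P^T *m P = B ->
  conjmap P (reflection B v) = reflection 1%:M (P *m v).
Proof.
move=> Pu PB; have PvB : bform 1%:M (P *m v) (P *m v) = bform B v v.
  by rewrite !bformE mulmx1 trmx_mul -PB !mulmxA.
(* Writing [B] as [P^T P] cancels [invmx P] and leaves [(P v)^T]. *)
have PBP : P *m (v *m v^T *m B) *m invmx P = P *m v *m (P *m v)^T.
  by rewrite trmx_mul -PB !mulmxA mulmxK.
have conj_sub (c : R) N :
    P *m (1%:M - c *: N) *m invmx P = 1%:M - c *: (P *m N *m invmx P).
  by rewrite mulmxBr mulmx1 mulmxBl mulmxV // -scalemxAr -scalemxAl.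
by rewrite /conjmap /reflection conj_sub PBP PvB mulmx1.
Qed.

(* [P] is [D] times the diagonal matrix of the [sqrt (B i i)]. *)
Lemma isometry_of_normalized_basis (B D C P : 'M[R]_d) :
  (forall i, 0 < B i i) ->
  C = \matrix_(i, j) (B i j / Num.sqrt (B i i * B j j)) -> posdef_sqrtmx C D ->
  (forall i, P *m ((Num.sqrt (B i i))^-1 *: basis_vec R i) = D *m basis_vec R i) ->
  P \in unitmx /\ P^T *m P = B.
Proof.
move=> B0 CE [Dpos DD] PE; have Du := posdefmx_unit Dpos; have [Dsym _] := Dpos.
pose n : 'rV[R]_d := \row_i Num.sqrt (B i i).
have n0 i : n 0 i != 0 by rewrite mxE sqrtr_eq0 -ltNge.
have PDn : P = D *m diag_mx n.
  apply/matrixP => i j; rewrite mul_mx_diag mxE.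
  have := congr1 (fun M : 'cV_d => M i 0) (PE j).
  rewrite /basis_vec -scalemxAr -!colE !mxE => <-.
  have := n0 j; rewrite mxE => nj.
  by rewrite mulrAC mulVf // mul1r.
split.
  rewrite PDn unitmx_mul Du unitmxE det_diag unitfE.
  by apply/prodf_neq0 => i _.
(* [P^T P] is [C] multiplied by [diag_mx n] on both sides, which undoes the normalization of [C]. *)
rewrite PDn trmx_mul tr_diag_mx Dsym -mulmxA [D *m _]mulmxA DD CE.
apply/matrixP => i j; rewrite mul_diag_mx mul_mx_diag !mxE.
rewrite sqrtrM ?ltW //.
have := n0 j; have := n0 i; rewrite !mxE => ni nj.
by field; rewrite ni nj.
Qed.

(** The entries [(i, j)] and [(j, i)] of [B] are divided by the same nonzero number. *)
Lemma sym_of_normalized (B C : 'M[R]_d) :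
  (forall i, 0 < B i i) ->
  C = \matrix_(i, j) (B i j / Num.sqrt (B i i * B j j)) -> C^T = C -> B^T = B.
Proof.
move=> B0 CE Csym; apply/matrixP => i j; rewrite mxE.
have := congr1 (fun M : 'M_d => M i j) Csym; rewrite CE !mxE mulrC [B i i * _]mulrC.
rewrite [RHS]mulrC => /mulfI; apply.
by rewrite invr_neq0 // sqrtr_eq0 -ltNge mulr_gt0.
Qed.

End LinearAlgebra.

(** * Irreducibility and the positivity of [A_i] *)

Section Irreducible.
Variables (d : nat) (S : {fset 'rV[int]_d}).

(** If the first step does not raise coordinate [i], the rest of the path still ends above its own
    starting point. *)
Lemma path_up_step (i : 'I_d) (P : 'rV[int]_d) (l : seq 'rV[int]_d) :
  path (fun x y => y - x \in S) P l -> P 0 i < last P l 0 i ->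
  exists2 s, s \in S & 0 < s 0 i.
Proof.
elim: l P => [|Q l IH] P /=; first by rewrite ltxx.
move=> /andP[PQ /IH QI] lt_P.
have [lt_PQ|le_QP] := ltP (P 0 i) (Q 0 i); last exact: QI (le_lt_trans le_QP lt_P).
by exists (Q - P); rewrite // !mxE subr_gt0.
Qed.

Lemma irreducible_up_step (i : 'I_d) : small_steps S -> irreducible_in_orthant S ->
  exists2 s, s \in S & s 0 i = 1.
Proof.
move=> S_small S_irr.
(* A walk from the origin to [e_i] has to raise coordinate [i]. *)
have [||n [l [_ _ /and3P[Sl _ /eqP lE]]]] := S_irr 0 (delta_mx 0 i).
- by apply/forallP => j; rewrite mxE.
- by apply/forallP => j; rewrite mxE ler0n.
have [|s sS s0] := path_up_step (i := i) Sl; first by rewrite lE !mxE !eqxx.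
by exists s => //; have := S_small s i sS; rewrite !inE => /or3P[] /eqP E; rewrite E in s0 *.
Qed.

Lemma inventory_coef1_gt0 (R : realType) (w : 'rV[int]_d -> R) i (x : 'rV[R]_d) :
  small_steps S -> irreducible_in_orthant S -> (forall s, s \in S -> 0 < w s) ->
  (forall j, 0 < x 0 j) -> 0 < inventory_coef idfun S w i 1 x.
Proof.
move=> S_small S_irr w_gt0 x_gt0.
have [s sS si] := irreducible_up_step i S_small S_irr.
have prod_gt0 t : 0 < \prod_(j < d | j != i) x 0 j ^ (t : 'rV[int]_d) 0 j.
  by apply: prodr_gt0 => j _; apply: exprz_gt0.
rewrite /inventory_coef big_mkcond (bigD1_seq s) ?fset_uniq //= si eqxx.
rewrite ltr_wpDr //; last by rewrite mulr_gt0 ?w_gt0.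
rewrite big_seq_cond; apply: sumr_ge0 => t /andP[tS _]; case: ifP => // _.
by rewrite mulr_ge0 // ltW // w_gt0.
Qed.

End Irreducible.

(** * The image of a group of rational maps under [jac] *)

Section JacobianImage.
Variables (R : realType) (d : nat) (x : 'rV[R]_d) (A : set 'rV[ratfun R d]_d).
Hypothesis A_involutive :
  forall g, A g -> fixes x g /\ ratmap_comp g g = generic_point R d.
Local Notation G := (generated (@ratmap_comp R d) (generic_point R d) A).

Lemma jac_generatedM g h : G g -> G h ->
  jac x (ratmap_comp g h) = jac x g *m jac x h.
Proof.
move=> Gg Gh; have [gx _] := generated_fixes A_involutive Gg.
by have [hx _] := generated_fixes A_involutive Gh; apply: jac_comp hx gx.
Qed.

(** Multiplicativity of [jac x] is available on [G], not on arbitrary rational maps, so both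
    inductions keep track of membership in [G]. *)
Lemma jac_generated : jac x @` G = mxgroup (jac x @` A).
Proof.
apply/seteqP; split=> [_ [g Gg <-]|M].
  elim: Gg => {g} [g Ag||g h Gg IHg Gh IHh|g h Gg IHg gh hg].
  - by apply: generated_in; exists g.
  - by rewrite jac_generic_point; apply: generated_unit.
  - have := generated_op IHg IHh; rewrite -(jac_generatedM Gg Gh); exact.
  - have Gh := generated_inv Gg gh hg.
    have ghJ := jac_generatedM Gg Gh; have hgJ := jac_generatedM Gh Gg.
    rewrite gh jac_generic_point in ghJ; rewrite hg jac_generic_point in hgJ.
    exact: generated_inv IHg (esym ghJ) (esym hgJ).
elim=> {M} [_ [g Ag <-]||M N _ [g Gg <-] _ [h Gh <-]|M N _ [g Gg <-] MN NM].
- by exists g => //; apply: generated_in.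
- by exists (generic_point R d); [exact: generated_unit | exact: jac_generic_point].
- by exists (ratmap_comp g h); [exact: generated_op | exact: jac_generatedM].
(* [N] is the inverse matrix of [jac x g], hence the image of the inverse of [g] in [G]. *)
have [gx [h [Gh hx gh hg]]] := generated_fixes A_involutive Gg.
exists h => //; have hgJ := jac_generatedM Gh Gg.
rewrite hg jac_generic_point in hgJ.
by rewrite -[LHS]mulmx1 -MN mulmxA -hgJ mul1mx.
Qed.

End JacobianImage.

(** * Comparison of the two reflection groups *)

Theorem corollary6 (R : realType) (d : nat)
    (S : {fset 'rV[int]_d}) (w : 'rV[int]_d -> R)
    (x0 : 'rV[R]_d) (D Phi : 'M[R]_d)
    (d_gt0 : (0 < d)%N)
    (S_small : small_steps S)
    (w_gt0 : forall s, s \in S -> 0 < w s)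
    (w_sum : \sum_(s <- S) w s = 1)
    (S_irr : irreducible_in_orthant S)
    (x0_crit : critical_point S w x0)
    (D_sqrt : posdef_sqrtmx (covariance S w x0) D)
    (PhiE : forall i,
      Phi *m normalized_basis S w x0 i = D *m basis_vec R i) :
  let mul := fun M N : 'M[R]_d => M *m N in
  let phi := involution_gen S w in
  let G := combinatorial_group S w in
  let J := jac x0 in
  let ImJ := J @` G in
  let r := simple_reflection D in
  let H := reflection_group_of D in
  let Phit := conjmap Phi in
  [/\ reflection_group (hessian S w x0) ImJ,
      reflection_group 1%:M H,
      group_isomorphism mul mul ImJ H Phit,
      forall i, Phit (J (phi i)) = r i
    & [/\ group_morphism (@ratmap_comp R d) mul G H (Phit \o J),
          (Phit \o J) @` G = H
        & forall i, (Phit \o J) (phi i) = r i]].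
Proof.
move=> mul phi G J ImJ r H Phit.
have [x_gt0 x_crit] := x0_crit.
have x_neq0 j : x0 0 j != 0 by rewrite gt_eqF.
pose B := hessian S w x0.
have A_gt0 i := inventory_coef1_gt0 i S_small S_irr w_gt0 x_gt0.
have A_neq0 i : inventory_coef idfun S w i 1 x0 != 0 by rewrite gt_eqF.
have slope0 i : chi_slope S w i x0 = 0 by rewrite -(partial_chi _ S_small) ?x_crit.
(* The equation [L_i = 0] at [x0] gives [C_i = A_i x_i^2]. From it come the Hessian diagonal in
   terms of [A_i], the nonvanishing of [C_i] and the invariance of [x0] under the involutions. *)
have CE i : inventory_coef idfun S w i (-1) x0
    = inventory_coef idfun S w i 1 x0 * x0 0 i ^+ 2.
  have /eqP := slope0 i; rewrite /chi_slope subr_eq0 => /eqP ->.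
  by rewrite mulrAC -exprMn mulVf // expr1n mul1r.
have BiiE i : B i i = 2 * inventory_coef idfun S w i 1 x0 / x0 0 i.
  by rewrite /B hessian_chi_diag // CE; field; rewrite x_neq0.
have B_gt0 i : 0 < B i i by rewrite BiiE divr_gt0 // mulr_gt0.
have C_neq0 i : inventory_coef idfun S w i (-1) x0 != 0.
  by rewrite CE mulf_neq0 ?expf_neq0.
have [[D_sym D_pos] DD] := D_sqrt.
have C_sym : (covariance S w x0)^T = covariance S w x0.
  by rewrite -DD trmx_mul D_sym.
(* The symmetry of the mixed partial derivatives is read off the symmetry of the
   covariance matrix, which is the square of a symmetric matrix. *)
have B_sym : B^T = B := sym_of_normalized B_gt0 erefl C_sym.
have nbE i : normalized_basis S w x0 i = (Num.sqrt (B i i))^-1 *: basis_vec R i.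
  by rewrite /normalized_basis bform_basis.
have [Phi_unit PhiB] : Phi \in unitmx /\ Phi^T *m Phi = B.
  apply: (isometry_of_normalized_basis B_gt0 erefl D_sqrt) => i.
  by rewrite -nbE PhiE.
have phi_at i : involution_at S w idfun i x0 = x0.
  apply/rowP => j; have [->|ji] := eqVneq j i; last by rewrite involution_at_id.
  by rewrite mxE eqxx CE; field; rewrite x_neq0 A_neq0.
have phi_fixes g : range phi g -> fixes x0 g /\ ratmap_comp g g = generic_point R d.
  move=> [i _ <-]; split; last exact: involution_gen_involutive (x_neq0) _ _.
  by have := ratmap_at_involution x_neq0 (A_neq0 i); rewrite phi_at.
have J_phi i : J (phi i) = reflection B (basis_vec R i).
  have rowB : \row_j hessian S w x0 j i = (basis_vec R i)^T *m B.
    rewrite trmx_delta -rowE; apply/rowP => j.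
    by rewrite [LHS]mxE [RHS]mxE -[LHS]/(B j i) -[in LHS]B_sym mxE.
  have cB : x0 0 i / inventory_coef idfun S w i 1 x0 = 2 / B i i.
    by rewrite BiiE; field; rewrite A_neq0 x_neq0.
  by rewrite /J /phi (jac_involution S_small) // /reflection bform_basis -mulmxA rowB cB.
have sqrtB_neq0 i : Num.sqrt (B i i) != 0 by rewrite sqrtr_eq0 -ltNge.
have Phi_J i : Phit (J (phi i)) = r i.
  rewrite J_phi /Phit (conjmap_reflection _ Phi_unit PhiB) /r /simple_reflection.
  (* [u_i] is [Phi e_i] divided by the square root of [B i i], and scaling preserves the
     reflection. *)
  rewrite -PhiE nbE -scalemxAr reflection_scale //.
  by rewrite invr_neq0.
have ImJE : ImJ = mxgroup (J @` range phi) := jac_generated phi_fixes.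
have rE : Phit @` (J @` range phi) = range r.
  by rewrite !image_comp; apply: eq_imagel => i _; apply: Phi_J.
(* This equality of sets yields both that [Phit] lands in [H] and that it is onto. *)
have HE : Phit @` ImJ = H by rewrite ImJE conjmap_mxgroup // rE.
have PhitM M N : Phit (mul M N) = mul (Phit M) (Phit N) by apply: conjmapM.
have JM g h : G g -> G h -> J (ratmap_comp g h) = mul (J g) (J h).
  exact: jac_generatedM phi_fixes _ _.
split=> //.
- exists (range (@basis_vec R d)) => [_ [i _ <-]|]; first by rewrite bform_basis.
  rewrite [LHS]ImJE !image_comp; congr mxgroup.
  by apply: eq_imagel => i _; apply: J_phi.
(* The squared norm of [u_i] is the entry [(i, i)] of [D *m D], a diagonal entry of the covariance
   matrix. *)
- exists (range (fun i => D *m basis_vec R i)) => [_ [i _ <-]|].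
    rewrite bformE mulmx1 trmx_mul D_sym mulmxA -[_ *m D *m D]mulmxA DD -bformE.
    rewrite bform_basis mxE divr_gt0 ?sqrtr_gt0 ?mulr_gt0 //; exact: B_gt0.
  by rewrite image_comp.
- split; first by split=> [M ImM|M N _ _]; [rewrite -HE; exists M | exact: PhitM].
  split=> [M ImM|M N _ _ MN|N]; first by rewrite -HE; exists M.
    by rewrite -(conjmapK M Phi_unit) -(conjmapK N Phi_unit); congr (conjmap _ _).
  by rewrite -HE.
split=> //; last by rewrite -HE image_comp.
split=> [g Gg|g h Gg Gh]; first by rewrite -HE; exists (J g) => //; exists g.
by rewrite /= JM // PhitM.
Qed.
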